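(* The class of nowhere dense ultrafilters on $\omega$ is closed under nowhere dense sums: if $u$ and $v_n$ ($n<\omega$) are nowhere dense ultrafilters on $\omega$, then $\sum_u\langle v_n:n<\omega\rangle$ is a nowhere dense ultrafilter.
   Context: An ultrafilter $u$ on $\omega$ is nowhere dense if for every $F:\omega\to{}^\omega2$ there is $A\in u$ such that $F(A)$ is nowhere dense in ${}^\omega 2$ (Cantor space with the product topology). If $u$ and $v_n$ ($n<\omega$) are ultrafilters on $\omega$, then $\sum_u\langle v_n:n<\omega\rangle$ is the ultrafilter on $\omega\times\omega$ consisting of all $Z\subseteq\omega\times\omega$ with $\{n:\{m:(n,m)\in Z\}\in v_n\}\in u$; it is regarded as an ultrafilter on $\omega$ via a bijection $\omega\times\omega\to\omega$ (isomorphic ultrafilters are identified). *)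

(* Defs.v *)
From HB Require Import structures.
From mathcomp Require Import all_boot all_order all_algebra.
From mathcomp Require Import all_classical all_reals all_analysis.

Set Implicit Arguments.
Unset Strict Implicit.
Unset Printing Implicit Defensive.

Local Open Scope classical_set_scope.

Definition nowhere_dense (T : topologicalType) (A : set T) : Prop :=
  (closure A)° = set0.

(* Principal ultrafilters are not excluded: they are trivially nowhere dense. *)
Definition nowhere_dense_ultrafilter (u : set_system nat) : Prop :=
  UltraFilter u /\
  forall F : nat -> cantor_space, exists2 A : set nat, u A & nowhere_dense (F @` A).

Definition ultrafilter_sum (u : set_system nat) (v : nat -> set_system nat) :
    set_system (nat * nat) :=
  [set Z | u [set n | v n [set m | Z (n, m)]]].

(* Main.v *)
Require Import Defs.
From HB Require Import structures.
From mathcomp Require Import all_boot all_order all_algebra.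
From mathcomp Require Import all_classical all_reals all_analysis.

(** The limits [x n] of [F (n, -)] along [v n] form a sequence in the Cantor
    space, so [x] has nowhere dense image on some [A] in [u]. For each [n],
    some [B n] in [v n] has nowhere dense image and only contains [m] such that
    [F (n, m)] agrees with [x n] up to [n]. A basic clopen set given by a word
    of length [N] and missing all [x n] with [n] in [A] can then meet
    [F ({n} * B n)] only for [n < N], so that only a finite union of nowhere
    dense sets has to be avoided inside it. *)

Local Open Scope classical_set_scope.

(** Converse of [in_ultra_setVsetC]: a member of a finer proper filter [G] missing from [F] would
    have its complement in [F], hence in [G]. *)
Lemma ultra_setVsetC {T : Type} {F : set_system T} :
  ProperFilter F -> (forall A, F A \/ F (~` A)) -> UltraFilter F.
Proof.
move=> FF FVC; split=> // G GG FG; apply/seteqP; split=> // A GA.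
have [//|/FG GnA] := FVC A.
by have /filter_ex [? []] : G (A `&` ~` A) by exact: filterI.
Qed.

Lemma fmap_ultra {T U : Type} (f : T -> U) {F : set_system T} :
  UltraFilter F -> UltraFilter (fmap f F).
Proof.
move=> FU; apply: ultra_setVsetC => A.
exact: (in_ultra_setVsetC (f @^-1` A) FU).
Qed.

(** The dichotomy is applied twice: [u] decides whether most sections of [Z] are large, and if not,
    [v n] contains the complementary section for [u]-most [n]. *)
Lemma ultrafilter_sum_ultra {u : set_system nat} {v : nat -> set_system nat} :
  UltraFilter u -> (forall n, UltraFilter (v n)) ->
  UltraFilter (ultrafilter_sum u v).
Proof.
move=> uU vU.
have sF : Filter (ultrafilter_sum u v).
  split.
  - by apply: (@filterE _ u) => n; exact: (@filterE _ (v n)).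
  - move=> P Q uP uQ; apply: (@filterS2 _ u) uP uQ => n vP vQ.
    exact: filterI vP vQ.
  - move=> P Q PQ; apply: (@filterS _ u) => n; apply: filterS => m; exact: PQ.
have s0 : ~ ultrafilter_sum u v set0.
  by move=> /(@filter_ex _ u) [n /(@filter_ex _ (v n)) [m]].
have sPF : ProperFilter (ultrafilter_sum u v) by split.
apply: ultra_setVsetC => Z.
have [|un] := in_ultra_setVsetC [set n | v n [set m | Z (n, m)]] uU.
  by left.
right; apply: (@filterS _ u) un => n nvZ.
by have [|] := in_ultra_setVsetC [set m | Z (n, m)] (vU n).
Qed.

Section NowhereDense.
Context {T : topologicalType}.
Implicit Types A B U : set T.

(** This form without closures lets several sets be avoided in turn, by shrinking an open set step
    by step. *)
Lemma nowhere_denseP A : nowhere_dense A <->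
  forall U, open U -> U !=set0 ->
    exists V, [/\ open V, V !=set0, V `<=` U & V `&` A = set0].
Proof.
split=> [ndA U oU [p Up]|avoid].
- exists (U `&` ~` closure A); split.
  + by apply: openI => //; rewrite openC; exact: closed_closure.
  + apply: contrapT => /nonemptyPn UA0.
    suff : (closure A)° p by rewrite ndA.
    rewrite /interior nbhsE; exists U => // y Uy; apply: contrapT => ncly.
    by have : set0 y by rewrite -UA0.
  + by move=> ? [].
  + by apply/seteqP; split=> // y [[_ ncly] /(@subset_closure _ A)].
- apply/seteqP; split=> // p intp.
  have [V [oV [q Vq] VA V0]] := avoid _ (open_interior (closure A))
    (ex_intro _ p intp).
  have /interior_subset clq := VA _ Vq.
  have [|z [Az Vz]] := clq V; first exact: open_nbhs_nbhs.
  by have : set0 z by rewrite -V0.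
Qed.

Lemma nowhere_dense_sub A B : A `<=` B -> nowhere_dense B -> nowhere_dense A.
Proof.
move=> AB ndB; apply/seteqP; split=> //; rewrite -ndB.
exact/interiorS/closureS.
Qed.

Lemma nowhere_dense0 : nowhere_dense (@set0 T).
Proof. by rewrite /nowhere_dense closure0 interior0. Qed.

Lemma nowhere_denseU A B :
  nowhere_dense A -> nowhere_dense B -> nowhere_dense (A `|` B).
Proof.
move=> /nowhere_denseP avA /nowhere_denseP avB; apply/nowhere_denseP => U oU U0.
have [V [oV V0 VU VA]] := avA U oU U0.
have [W [oW W0 WV WB]] := avB V oV V0.
exists W; split=> //; first exact: subset_trans VU.
by rewrite setIUr WB setU0; apply: subsetI_eq0 VA.
Qed.

Lemma nowhere_dense_bigcup_lt (B : nat -> set T) (N : nat) :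
  (forall n, nowhere_dense (B n)) -> nowhere_dense (\bigcup_(n < N) B n).
Proof.
move=> ndB; elim: N => [|N IH].
  by rewrite bigcup_mkord big_ord0; exact: nowhere_dense0.
rewrite bigcup_mkord big_ord_recr -bigcup_mkord; exact: nowhere_denseU.
Qed.

End NowhereDense.

Definition cylinder (p : cantor_space) (N : nat) : set cantor_space :=
  [set y | forall i, (i < N)%N -> y i = p i].

(** Each coordinate converges in a discrete space, so it is eventually constant, and only [N]
    coordinates are involved. A general [G] covers both limits along an ultrafilter and the filter
    [nbhs p]. *)
Lemma near_cylinder (G : set_system cantor_space) (p : cantor_space) N :
  Filter G -> G --> p -> G (cylinder p N).
Proof.
move=> FG Gp.
have GI (i : 'I_N) : G [set y : cantor_space | y (i : nat) = p i].
  have /pointwise_cvgP/(_ (i : nat)) := Gp.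
  by move/discrete_cvg.
have := @filter_forall _ 'I_N (fun i (y : cantor_space) => y i = p i) G FG GI.
by apply: filterS => y yp i iN; exact: (yp (Ordinal iN)).
Qed.

(** The filter generated by the cylinders around [p] converges to [p] coordinatewise, hence in the
    product topology, so it contains every neighbourhood of [p]. *)
Lemma nbhs_cylinder (p : cantor_space) (U : set cantor_space) :
  nbhs p U -> exists N, cylinder p N `<=` U.
Proof.
have decr N N' : (N <= N')%N -> cylinder p N' `<=` cylinder p N.
  by move=> le y yp i iN; apply: yp; exact: leq_trans le.
pose G := filter_from setT (cylinder p).
have FG : Filter G.
  apply: filter_from_filter => [|N N' _ _]; first by exists 0%N.
  exists (maxn N N') => // y yp.
  by split; apply: decr yp; rewrite ?leq_maxl ?leq_maxr.
suff Gp : G --> p by move=> /Gp [N _ NU]; exists N.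
apply/pointwise_cvgP => t; apply/discrete_cvg.
(* Length [t.+1] is the least that fixes coordinate [t]. *)
by exists t.+1 => // y; exact.
Qed.

(** Working with maps on pairs postpones the coding of pairs by naturals to the theorem. *)
Lemma nowhere_dense_sum_image (u : set_system nat) (v : nat -> set_system nat)
    (F : nat * nat -> cantor_space) :
  nowhere_dense_ultrafilter u -> (forall n, nowhere_dense_ultrafilter (v n)) ->
  exists2 Z, ultrafilter_sum u v Z & nowhere_dense (F @` Z).
Proof.
move=> [uU ndu] ndv.
have vU n : UltraFilter (v n) by case: (ndv n).
pose vF n : set_system cantor_space := fmap (fun m => F (n, m)) (v n).
have /choice [x vx] n : exists p : cantor_space, vF n --> p.
  have vFU : UltraFilter (vF n) by exact: fmap_ultra.
  have := cantor_space_compact; rewrite compact_ultra.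
  by move=> /(_ (vF n) vFU filterT) [p [_]]; exists p.
have [A uA /nowhere_denseP avA] := ndu x.
have /choice [B vB] n : exists B : set nat,
    [/\ v n B, nowhere_dense [set F (n, m) | m in B] &
        forall m, B m -> cylinder (x n) n (F (n, m))].
  have [_ /(_ (fun m => F (n, m))) [B vB ndB]] := ndv n.
  have vC : v n [set m | cylinder (x n) n (F (n, m))].
    exact: (near_cylinder (vF n)).
  exists (B `&` [set m | cylinder (x n) n (F (n, m))]); split.
  - exact: filterI.
  - by apply: nowhere_dense_sub ndB; apply: image_subset => ? [].
  - by move=> m [].
exists [set nm | A nm.1 /\ B nm.1 nm.2].
  apply: (@filterS _ u) uA => n An.
  by have [vBn _ _] := vB n; apply: (@filterS _ (v n)) vBn.
apply/nowhere_denseP => U oU U0.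
have [V [oV [p Vp] VU VA]] := avA U oU U0.
have [N NV] := nbhs_cylinder _ _ (open_nbhs_nbhs (conj oV Vp)).
have pN : nbhs p (cylinder p N) by exact: near_cylinder.
have /nowhere_denseP avB : nowhere_dense
    (\bigcup_(n < N) [set F (n, m) | m in B n]).
  by apply: nowhere_dense_bigcup_lt => n; case: (vB n).
(* Passing to the interior, nonempty because it contains [p], supplies an open set without a
   separate proof that cylinders are open. *)
have [W [oW W0 WC WB]] :=
  avB _ (open_interior (cylinder p N)) (ex_intro _ p pN).
have WN : W `<=` cylinder p N by move=> y /WC /interior_subset.
exists W; split=> //; first exact: subset_trans WN (subset_trans NV VU).
apply/seteqP; split=> // y [Wy [[n m] /= [An Bm] Fy]].
have [nN|Nn] := ltnP n N.
  by suff: set0 y by []; rewrite -WB; split=> //; exists n => //; exists m.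
(* Here [N <= n]: [x n] agrees with [y] below [N], and so does [p]. Hence [x n] lies in [V], which
   misses the image of [A] under [x]. *)
have [_ _ /(_ m Bm) xF] := vB n.
have xC : cylinder p N (x n).
  by move=> i iN; rewrite -(WN _ Wy i iN) -Fy (xF i (leq_trans iN Nn)).
by suff: set0 (x n) by []; rewrite -VA; split; [exact: NV|exists n].
Qed.

Theorem theorem2p4 (u : set_system nat) (v : nat -> set_system nat)
    (hu : nowhere_dense_ultrafilter u)
    (hv : forall n : nat, nowhere_dense_ultrafilter (v n))
    (e : nat * nat -> nat) (he : bijective e) :
  nowhere_dense_ultrafilter (fmap e (ultrafilter_sum u v)).
Proof.
have sU : UltraFilter (ultrafilter_sum u v).
  by apply: ultrafilter_sum_ultra => [|n]; [case: hu|case: (hv n)].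
split; first exact: fmap_ultra.
move=> F; have [Z sZ ndZ] := nowhere_dense_sum_image u v (F \o e) hu hv.
(* The preimage under [e] of this image contains [Z], and [F] maps the image onto the set already
   handled for [F \o e]. *)
exists (e @` Z); first by apply: filterS sZ; exact: preimage_image.
by rewrite image_comp.
Qed.
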